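(* Let $K$ be a fixed matrix in $\mathbb{C}^{n\times m}$ and let $t=p/q$ be any rational number in $[-1,2]$. Let $F_t(A,B)=\operatorname{tr}\left[K^*A^{1-t}KB^t\right]$ for $(A,B)\in\mathbf{H}^n_{++}\times\mathbf{H}^m_{++}$. \begin{itemize} \item If $t=p/q\in[0,1]$, then $F_t$ is concave and its hypograph $\{(A,B,\tau)\in\mathbf{H}^n_{++}\times\mathbf{H}^m_{++}\times\mathbb{R}: F_t(A,B)\geq\tau\}$ admits a semidefinite programming representation using at most $2\lfloor\log_2 q\rfloor+1$ LMIs of size $2nm\times 2nm$, one LMI of size $nm\times nm$ and one scalar inequality. \item If $t=p/q\in[-1,0]\cup[1,2]$, then $F_t$ is convex and its epigraph $\{(A,B,\tau)\in\mathbf{H}^n_{++}\times\mathbf{H}^m_{++}\times\mathbb{R}: F_t(A,B)\leq\tau\}$ admits a semidefinite programming representation using at most $2\lfloor\log_2 q\rfloor+2$ LMIs of size $2nm\times 2nm$, one LMI of size $nm\times nm$ and one scalar inequality. \end{itemize}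
   Context: $\mathbf{H}^n$ denotes the space of $n\times n$ complex Hermitian matrices, $\mathbf{H}^n_{++}$ the cone of positive definite ones; $K^*$ is the conjugate transpose; $X\succeq0$ means $X$ is positive semidefinite. Concavity/convexity of $F_t$ is joint in $(A,B)$. Here $p,q$ are integers with $q\ge1$. A linear matrix inequality (LMI) of size $N$ (or $N\times N$) in real variables $y_1,\dots,y_k$ is a condition $A_0+y_1A_1+\dots+y_kA_k\succeq 0$ with $A_0,\dots,A_k\in\mathbf{H}^N$ fixed; a scalar inequality is an LMI of size $1$. A convex set has a semidefinite programming (SDP) representation if it can be expressed using LMIs, where auxiliary (lifting) variables are allowed: a point $x$ is in the set if and only if there exist auxiliary variables $y$ such that $(x,y)$ satisfies finitely many LMIs. The size of the representation is recorded by the number of LMIs of each size. Convention: the matrix variables $A,B$ are implicitly restricted to the positive definite cones, and this restriction is not counted among the LMIs. *)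

(* Defs.v *)
(* Complex numbers are R[i] for R : realType, ordered by x <= y iff y - x is
   real and >= 0. *)
From Stdlib Require List.
From HB Require Import structures.
From mathcomp Require Import all_boot all_order all_algebra.
From mathcomp Require Import sesquilinear spectral.
From mathcomp Require Import complex.
From mathcomp Require Import classical_sets reals exp.

Set Implicit Arguments.
Unset Strict Implicit.
Unset Printing Implicit Defensive.

Import Order.TTheory GRing.Theory Num.Theory.

Local Open Scope ring_scope.
Local Open Scope complex_scope.
Local Open Scope sesquilinear_scope.

Definition psdmx (R : realType) (n : nat) (X : 'M[R[i]]_n) : Prop :=
  X \is hermsymmx /\
  forall v : 'cV[R[i]]_n, 0 <= (v ^t* *m X *m v) ord0 ord0.

Definition pdmx (R : realType) (n : nat) (X : 'M[R[i]]_n) : Prop :=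
  X \is hermsymmx /\
  forall v : 'cV[R[i]]_n, v != 0 -> 0 < (v ^t* *m X *m v) ord0 ord0.

(* Spectral calculus: A = P^-1 diag(d) P with P unitary is sent to
   P^-1 diag(d^s) P.  Meaningful for positive definite A, where d > 0. *)
Definition pdpow (R : realType) (n : nat) (A : 'M[R[i]]_n) (s : R) :
    'M[R[i]]_n :=
  invmx (spectralmx A)
  *m diag_mx (map_mx (fun z : R[i] => ((complex.Re z) `^ s)%:C)
                     (spectral_diag A))
  *m spectralmx A.

(* Complex-valued; an inequality between a value and a real, or between two
   values, taken in R[i], includes equality of the imaginary parts. *)
Definition lieb_trace (R : realType) (n m : nat) (K : 'M[R[i]]_(n, m)) (t : R)
    (A : 'M[R[i]]_n) (B : 'M[R[i]]_m) : R[i] :=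
  \tr (K ^t* *m pdpow A (1 - t) *m K *m pdpow B t).

Definition jointly_convex (R : realType) (n m : nat)
    (F : 'M[R[i]]_n -> 'M[R[i]]_m -> R[i]) : Prop :=
  forall (A1 A2 : 'M[R[i]]_n) (B1 B2 : 'M[R[i]]_m) (l : R),
    pdmx A1 -> pdmx A2 -> pdmx B1 -> pdmx B2 -> 0 <= l <= 1 ->
    F (l%:C *: A1 + (1 - l)%:C *: A2) (l%:C *: B1 + (1 - l)%:C *: B2)
      <= l%:C * F A1 B1 + (1 - l)%:C * F A2 B2.

Definition jointly_concave (R : realType) (n m : nat)
    (F : 'M[R[i]]_n -> 'M[R[i]]_m -> R[i]) : Prop :=
  forall (A1 A2 : 'M[R[i]]_n) (B1 B2 : 'M[R[i]]_m) (l : R),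
    pdmx A1 -> pdmx A2 -> pdmx B1 -> pdmx B2 -> 0 <= l <= 1 ->
    l%:C * F A1 B1 + (1 - l)%:C * F A2 B2
      <= F (l%:C *: A1 + (1 - l)%:C *: A2) (l%:C *: B1 + (1 - l)%:C *: B2).

Record lmi (R : realType) (d : nat) := Lmi {
  lmi_size : nat;
  lmi_const : 'M[R[i]]_lmi_size;
  lmi_coef : 'I_d -> 'M[R[i]]_lmi_size;
  lmi_const_herm : lmi_const \is hermsymmx;
  lmi_coef_herm : forall j, lmi_coef j \is hermsymmx }.

Definition lmi_holds (R : realType) (d : nat) (x : 'rV[R]_d) (L : lmi R d) :
    Prop :=
  psdmx (lmi_const L + \sum_(j < d) (x ord0 j)%:C *: lmi_coef L j).

(* S, a subset of the implicit domain D, is described over D by a list of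
   LMIs whose sizes are, in order, the entries of szs.  The points of T enter
   the LMIs through the real coordinates coord; y : 'rV_k are the lifting
   variables. *)
Definition sdp_representation (R : realType) (T : Type) (d : nat)
    (coord : T -> 'rV[R]_d) (D S : set T) (szs : seq nat) : Prop :=
  exists (k : nat) (Ls : seq (lmi R (d + k)%N)),
    [seq lmi_size L | L <- Ls] = szs /\
    forall x : T, D x ->
      (S x <-> exists y : 'rV[R]_k,
                 List.Forall (lmi_holds (row_mx (coord x) y)) Ls).

(* The real and imaginary parts of all entries.  On Hermitian matrices these
   coordinates are redundant, but their real linear combinations (with
   Hermitian matrix coefficients) are exactly the real-linear maps. *)
Definition mx_coord (R : realType) (n : nat) (A : 'M[R[i]]_n) :
    'rV[R]_(n * n + n * n)%N :=
  row_mx (mxvec (map_mx (@complex.Re R) A)) (mxvec (map_mx (@complex.Im R) A)).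

Definition triple_coord (R : realType) (n m : nat)
    (x : 'M[R[i]]_n * 'M[R[i]]_m * R) :
    'rV[R]_((n * n + n * n) + (m * m + m * m) + 1)%N :=
  row_mx (row_mx (mx_coord x.1.1) (mx_coord x.1.2)) (const_mx x.2).

Definition pd_domain (R : realType) (n m : nat) :
    set ('M[R[i]]_n * 'M[R[i]]_m * R) :=
  fun x => pdmx x.1.1 /\ pdmx x.1.2.

Definition hypograph (R : realType) (n m : nat)
    (F : 'M[R[i]]_n -> 'M[R[i]]_m -> R[i]) :
    set ('M[R[i]]_n * 'M[R[i]]_m * R) :=
  fun x => [/\ pdmx x.1.1, pdmx x.1.2 & x.2%:C <= F x.1.1 x.1.2].

Definition epigraph (R : realType) (n m : nat)
    (F : 'M[R[i]]_n -> 'M[R[i]]_m -> R[i]) :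
    set ('M[R[i]]_n * 'M[R[i]]_m * R) :=
  fun x => [/\ pdmx x.1.1, pdmx x.1.2 & F x.1.1 x.1.2 <= x.2%:C].

(* Main.v *)
(* Let A act on n x m matrices Y by A Y and B by Y B: these are commuting
   positive definite nm x nm matrices P and Q, simultaneously diagonalized by a
   unitary S, and F_t(A, B) = v^* P^(1-t) Q^t v with v = vec K.  In the form
   [expdiag S a] = S^* diag(e^a) S, the mean P^(1-s) Q^s =: P #_s Q becomes a
   convex combination of the logarithms a.

   [[P, Z], [Z, Q]] >= 0 forces Z <= P #_(1/2) Q, with equality allowed, so l
   such LMIs represent the hypograph of P #_(a/2^l) Q by bisection.  For
   2^l <= q < 2^(l+1) and p <= 2^l, P #_(p/q) Q is the largest Z with
   [[W1, Z], [Z, W2]] >= 0, W1 <= P #_(p/2^l) Q and W2 <= P #_(2-q/2^l) Z: this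
   takes 2l+1 LMIs, and p > 2^l reduces to it by exchanging P and Q.  Outside
   [0, 1], [[T, P], [P, W]] >= 0 with W <= P #_s Q says T >= P #_(-s) Q.
   Although Z need not commute with P and Q, comparing it with the exact mean
   through its largest relative eigenvalue keeps every bound commutative.

   Concavity and convexity follow from the representations, since a set cut out
   by LMIs with lifting variables is convex. *)
From Stdlib Require List.
Require Import Defs.
From mathcomp Require Import all_boot all_order all_algebra.
From mathcomp Require Import sesquilinear spectral complex classical_sets.
From mathcomp Require Import reals sequences exp.
From mathcomp Require Import zify ring lra.

Set Implicit Arguments.
Unset Strict Implicit.
Unset Printing Implicit Defensive.

Import Order.TTheory GRing.Theory Num.Theory.

Local Open Scope ring_scope.
Local Open Scope complex_scope.
Local Open Scope sesquilinear_scope.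

(** * Positive semidefinite matrices *)

Section Adjoint.
Variable C : numClosedFieldType.

Lemma adjmxM m n p (A : 'M[C]_(m, n)) (B : 'M[C]_(n, p)) :
  (A *m B) ^t* = B ^t* *m A ^t*.
Proof. by rewrite trmx_mul map_mxM. Qed.

Lemma adjmxD m n (A B : 'M[C]_(m, n)) : (A + B) ^t* = A ^t* + B ^t*.
Proof. by rewrite linearD map_mxD. Qed.

Lemma adjmxN m n (A : 'M[C]_(m, n)) : (- A) ^t* = - A ^t*.
Proof. by rewrite linearN map_mxN. Qed.

Lemma adjmxZ m n c (A : 'M[C]_(m, n)) : (c *: A) ^t* = c^* *: A ^t*.
Proof. by rewrite linearZ map_mxZ. Qed.

Lemma adjmx1 n : (1%:M : 'M[C]_n) ^t* = 1%:M.
Proof. by rewrite trmx1 map_mx1. Qed.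

Lemma adjmx_block m1 m2 n1 n2 (A : 'M[C]_(m1, n1)) (B : 'M[C]_(m1, n2))
    (D : 'M[C]_(m2, n1)) (E : 'M[C]_(m2, n2)) :
  (block_mx A B D E) ^t* = block_mx (A ^t*) (D ^t*) (B ^t*) (E ^t*).
Proof. by rewrite tr_block_mx map_block_mx. Qed.

Lemma adjmx_row m n1 n2 (A : 'M[C]_(m, n1)) (B : 'M[C]_(m, n2)) :
  (row_mx A B) ^t* = col_mx (A ^t*) (B ^t*).
Proof. by rewrite tr_row_mx map_col_mx. Qed.

Lemma adjmx_col m1 m2 n (A : 'M[C]_(m1, n)) (B : 'M[C]_(m2, n)) :
  (col_mx A B) ^t* = row_mx (A ^t*) (B ^t*).
Proof. by rewrite tr_col_mx map_row_mx. Qed.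

Lemma hermsymP n (A : 'M[C]_n) : reflect (A ^t* = A) (A \is hermsymmx).
Proof.
by apply: (iffP (is_hermitianmxP _ _ _)); rewrite expr0 scale1r => /esym.
Qed.

Lemma unitary_adjmxK n (S : 'M[C]_n) : S \is unitarymx -> S ^t* *m S = 1%:M.
Proof. by move=> uS; rewrite -invmx_unitary // mulVmx // unitarymx_unit. Qed.

Lemma unitary_mulmx_adj n (S : 'M[C]_n) : S \is unitarymx -> S *m S ^t* = 1%:M.
Proof. by move/unitarymxP. Qed.

Lemma adjmx_self_ge0 n (v : 'cV[C]_n) : 0 <= (v ^t* *m v) ord0 ord0.
Proof.
by rewrite mxE; apply: sumr_ge0 => i _; rewrite !mxE mulrC mul_conjC_ge0.
Qed.

Lemma adjmx_self_gt0 n (v : 'cV[C]_n) : v != 0 -> 0 < (v ^t* *m v) ord0 ord0.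
Proof.
move=> nz; rewrite lt_def adjmx_self_ge0 andbT; apply: contraNN nz.
rewrite mxE psumr_eq0 => [/allP h|i _]; last by rewrite !mxE mulrC mul_conjC_ge0.
apply/eqP/matrixP => i j; rewrite ord1 mxE; have := h i (mem_index_enum _).
by rewrite /= !mxE mulrC mul_conjC_eq0 => /eqP.
Qed.

End Adjoint.

Section Psd.
Variable C : numClosedFieldType.

(* [psdmx] over an abstract [C]; rewriting in [R[i]] is prohibitively slow. *)
Definition psd n (X : 'M[C]_n) :=
  X ^t* = X /\ forall v : 'cV[C]_n, 0 <= (v ^t* *m X *m v) ord0 ord0.

Lemma psd_herm n (X : 'M[C]_n) : psd X -> X ^t* = X.
Proof. by case. Qed.

Lemma psd0 n : psd (0 : 'M[C]_n).
Proof.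
split=> [|v]; first by rewrite trmx0 map_mx0.
by rewrite mulmx0 mul0mx mxE.
Qed.

Lemma psdD n (X Y : 'M[C]_n) : psd X -> psd Y -> psd (X + Y).
Proof.
move=> [hX pX] [hY pY]; split=> [|v]; first by rewrite adjmxD hX hY.
by rewrite mulmxDr mulmxDl mxE addr_ge0.
Qed.

Lemma psdZ n c (X : 'M[C]_n) : 0 <= c -> psd X -> psd (c *: X).
Proof.
move=> c0 [hX pX]; split=> [|v].
  by rewrite adjmxZ hX (CrealP (ger0_real c0)).
by rewrite -scalemxAr -scalemxAl mxE mulr_ge0.
Qed.

Lemma psd_congr n k (S : 'M[C]_(n, k)) (X : 'M[C]_n) :
  psd X -> psd (S ^t* *m X *m S).
Proof.
move=> [hX pX]; split=> [|v]; first by rewrite !adjmxM trmxCK hX mulmxA.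
by have := pX (S *m v); rewrite adjmxM !mulmxA.
Qed.

Lemma psd_gram n k (L : 'M[C]_(k, n)) : psd (L ^t* *m L).
Proof.
split=> [|v]; first by rewrite adjmxM trmxCK.
by have := adjmx_self_ge0 (L *m v); rewrite adjmxM !mulmxA.
Qed.

Lemma psd_diag n (d : 'rV[C]_n) : (forall i, 0 <= d ord0 i) -> psd (diag_mx d).
Proof.
move=> d0; split=> [|v].
  rewrite tr_diag_mx map_diag_mx; congr diag_mx; apply/matrixP => i j.
  by rewrite !mxE ord1; apply/CrealP/ger0_real.
rewrite mul_mx_diag mxE; apply: sumr_ge0 => i _; rewrite !mxE.
by rewrite mulrAC mulr_ge0 // mulrC mul_conjC_ge0.
Qed.

Lemma psd_le_qform n (X Y : 'M[C]_n) (v : 'cV[C]_n) : psd (Y - X) ->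
  (v ^t* *m X *m v) ord0 ord0 <= (v ^t* *m Y *m v) ord0 ord0.
Proof. by move=> [_ /(_ v)]; rewrite mulmxBr mulmxBl !mxE subr_ge0. Qed.

Lemma block_qform n k j (X : 'M[C]_n) Z Z' (Y : 'M[C]_k) (a : 'M[C]_(n, j))
    (b : 'M[C]_(k, j)) :
  (col_mx a b) ^t* *m block_mx X Z Z' Y *m col_mx a b
    = a ^t* *m X *m a + b ^t* *m Z' *m a + (a ^t* *m Z *m b + b ^t* *m Y *m b).
Proof. by rewrite adjmx_col mul_row_block mul_row_col !mulmxDl. Qed.

Lemma psd_block_diag n k (X : 'M[C]_n) (Y : 'M[C]_k) :
  psd X -> psd Y -> psd (block_mx X 0 0 Y).
Proof.
move=> [hX pX] [hY pY]; split=> [|v].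
  by rewrite adjmx_block hX hY !trmx0 !map_mx0.
rewrite -[v]vsubmxK block_qform !mulmx0 !mul0mx addr0 add0r.
by rewrite mxE addr_ge0.
Qed.

Lemma psd_block_le n (X X' Z Y Y' : 'M[C]_n) :
  psd (X' - X) -> psd (Y' - Y) -> psd (block_mx X Z Z Y) ->
  psd (block_mx X' Z Z Y').
Proof.
move=> hX hY hb; have := psdD (psd_block_diag hX hY) hb.
by rewrite add_block_mx !subrK !add0r.
Qed.

Lemma psd_block_herm n (X Z Y : 'M[C]_n) : psd (block_mx X Z Z Y) -> Z ^t* = Z.
Proof. by move=> /psd_herm; rewrite adjmx_block => /eq_block_mx []. Qed.

Lemma psd_block_qform n (X Z Y : 'M[C]_n) (a b : 'cV[C]_n) :
  psd (block_mx X Z Z Y) ->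
  0 <= (a ^t* *m X *m a + b ^t* *m Z *m a
        + (a ^t* *m Z *m b + b ^t* *m Y *m b)) ord0 ord0.
Proof. by move=> [_ /(_ (col_mx a b))]; rewrite block_qform. Qed.

Lemma psd_block_gram n (U W : 'M[C]_n) : U ^t* = U -> W ^t* = W ->
  psd (block_mx (U *m U) (U *m W) (W *m U) (W *m W)).
Proof.
move=> hU hW; have := psd_gram (row_mx U W).
by rewrite adjmx_row mul_col_row hU hW.
Qed.

(** Test the block matrix on the vector with parts [- (E *m x)] and [x]: each of the four terms is a
    multiple of [x^* Q x], with total [2 (1 - l)]. In use [G] is the geometric mean of [P] and [Q],
    and [l] an eigenvalue of [Z] relative to [G]. *)
Lemma psd_block_test n (P Q G E Z : 'M[C]_n) (x : 'cV[C]_n) l :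
  psd (block_mx P Z Z Q) -> G ^t* = G -> E ^t* = E -> E *m P *m E = Q ->
  E *m G = Q -> G *m E = Q -> l \is Num.real -> Z *m x = l *: (G *m x) ->
  0 <= (1 - l) * (x ^t* *m Q *m x) ord0 ord0.
Proof.
move=> hb hG hE EPE EG GE lreal Zx; have hZ := psd_block_herm hb.
have xZ : x ^t* *m Z = l *: (x ^t* *m G).
  by rewrite -{1}hZ -adjmxM Zx adjmxZ adjmxM hG (CrealP lreal).
have := psd_block_qform (- (E *m x)) x hb.
rewrite mulmxN adjmxN adjmxM hE !mulNmx !mulmxN opprK xZ -scalemxAl.
rewrite -(mulmxA _ Z x) Zx -scalemxAr.
have -> : x ^t* *m E *m P *m (E *m x) = x ^t* *m Q *m x by rewrite -EPE !mulmxA.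
have -> : x ^t* *m G *m (E *m x) = x ^t* *m Q *m x by rewrite -GE !mulmxA.
have -> : x ^t* *m E *m (G *m x) = x ^t* *m Q *m x by rewrite -EG !mulmxA.
move: (x ^t* *m Q *m x) => Y; rewrite !mxE; move: (Y ord0 ord0) => y.
have -> : y - l * y + (- (l * y) + y) = 2 * ((1 - l) * y) by ring.
by rewrite pmulr_rge0 ?ltr0n.
Qed.

Lemma spectral_herm n (H : 'M[C]_n) : H ^t* = H ->
  exists (V : 'M[C]_n) (d : 'rV[C]_n),
    [/\ V \is unitarymx, forall i, d ord0 i \is Num.real
      & H = V ^t* *m diag_mx d *m V].
Proof.
move/hermsymP => hH; exists (spectralmx H), (spectral_diag H).
split; first exact: spectral_unitarymx.
  by move=> i; have /mxOverP := hermitian_spectral_diag_real hH.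
rewrite -invmx_unitary ?spectral_unitarymx //.
exact/orthomx_spectralP/hermitian_normalmx.
Qed.

(** Diagonalize [G' *m Z *m G']: [Z] lies below [c *: (G *m G)] once [c] bounds all eigenvalues. If
    some eigenvalue exceeds 1, the largest one is the optimal [c], and it is attained. *)
Lemma psd_top_eigenvector n (Z G G' : 'M[C]_n) :
  Z ^t* = Z -> G ^t* = G -> G' ^t* = G' -> G *m G' = 1%:M ->
  psd (G *m G - Z) \/
  exists l (x : 'cV[C]_n), [/\ 1 < l, x != 0,
    psd (l *: (G *m G) - Z) & Z *m x = l *: (G *m G *m x)].
Proof.
move=> hZ hG hG' GG'; have G'G : G' *m G = 1%:M by apply: mulmx1C.
have hH : (G' *m Z *m G') ^t* = G' *m Z *m G'.
  by rewrite !adjmxM hZ hG' mulmxA.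
have [V [d [uV dreal HE]]] := spectral_herm hH.
have ZE : Z = G *m (V ^t* *m diag_mx d *m V) *m G.
  by rewrite -HE !mulmxA GG' mul1mx -mulmxA G'G mulmx1.
have bound c : (forall i, d ord0 i <= c) -> psd (c *: (G *m G) - Z).
  move=> hc; have -> : c *: (G *m G) - Z
      = (V *m G) ^t* *m diag_mx (const_mx c - d) *m (V *m G).
    rewrite adjmxM hG linearB /= diag_const_mx mulmxBr mulmxBl.
    rewrite mul_mx_scalar -scalemxAl. congr (_ *: _ - _).
      by rewrite !mulmxA -(mulmxA G) unitary_adjmxK // mulmx1.
    by rewrite ZE !mulmxA.
  by apply/psd_congr/psd_diag => i; rewrite !mxE subr_ge0.
have [le1|] := boolP [forall i, d ord0 i <= 1].
  by left; have := bound 1 (fun i => forallP le1 i); rewrite scale1r.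
rewrite negb_forall => /existsP[i0]; rewrite -real_ltNge ?real1 // => gt1.
have cmp : {in predT &, forall i j, (d ord0 i >=< d ord0 j)%O}.
  by move=> i j _ _; apply: real_comparable.
have [i _ imax] :=
  comparable_arg_maxP (i0 := i0) (P := predT) (F := d ord0) isT cmp.
right.
(* The eigenvector of [G' *m Z *m G'] for its largest eigenvalue, carried back by [G']. *)
exists (d ord0 i), (G' *m V ^t* *m delta_mx i ord0); split.
- exact: lt_le_trans gt1 (imax _ _).
- apply/eqP => /(congr1 (mulmx (V *m G))); rewrite mulmx0 !mulmxA -(mulmxA V).
  rewrite GG' mulmx1 unitary_mulmx_adj // mul1mx.
  move/matrixP => /(_ i ord0); rewrite !mxE !eqxx /= => /eqP.
  by rewrite oner_eq0.
- by apply: bound => j; apply: imax.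
rewrite ZE !mulmxA -(mulmxA _ G G') GG' mulmx1 -(mulmxA _ V) unitary_mulmx_adj //.
rewrite mulmx1 -(mulmxA G G G') GG' mulmx1 -mulmxA.
rewrite scalemxAr; congr (_ *m _); apply/matrixP => j k; rewrite mul_diag_mx !mxE.
by case: eqP => [->|]; rewrite ?mulr0 ?mulr1.
Qed.

End Psd.

(** * Commuting positive definite matrices in logarithmic coordinates *)

Section ExpDiag.
(* In use, [C] is [R[i]] and [toC] its embedding of [R]. *)
Variables (R : realType) (C : numClosedFieldType) (toC : {rmorphism R -> C}).
Hypothesis toC_le : {mono toC : x y / x <= y}.
Hypothesis toC_realP : forall z : C, z \is Num.real -> exists x, z = toC x.

Definition expdiag N (S : 'M[C]_N) (a : 'rV[R]_N) : 'M[C]_N :=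
  S ^t* *m diag_mx (map_mx (fun x => toC (expR x)) a) *m S.

Variables (N : nat) (S : 'M[C]_N).
Hypothesis unitS : S \is unitarymx.
Local Notation D := (expdiag S).

Let toC_ge0 x : (0 <= toC x) = (0 <= x).
Proof. by rewrite -(rmorph0 toC) toC_le. Qed.

Let half_add (V : lmodType R) (a : V) : 2^-1 *: a + 2^-1 *: a = a.
Proof. by rewrite -scalerDl (_ : 2^-1 + 2^-1 = 1) ?scale1r //; lra. Qed.

Lemma expdiag_herm a : (D a) ^t* = D a.
Proof.
have /psd_diag/psd_herm h i : 0 <= map_mx (fun x => toC (expR x)) a ord0 i.
  by rewrite mxE toC_ge0 expR_ge0.
by rewrite /expdiag !adjmxM trmxCK h mulmxA.
Qed.

Lemma expdiagD a b : D a *m D b = D (a + b).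
Proof.
rewrite /expdiag !mulmxA -(mulmxA _ S) unitary_mulmx_adj // mulmx1.
rewrite -(mulmxA (S ^t*)) mulmx_diag; congr (_ *m diag_mx _ *m _).
by apply/matrixP => i j; rewrite !mxE expRD rmorphM ord1.
Qed.

Lemma expdiag0 : D 0 = 1%:M.
Proof.
rewrite /expdiag; have -> : map_mx (fun x => toC (expR x)) 0 = const_mx 1 :> 'rV_N.
  by apply/matrixP => i j; rewrite !mxE expR0 rmorph1.
by rewrite diag_const_mx mulmx1 unitary_adjmxK.
Qed.

(** Scaling is a shift of the logarithms, so a bound [Z <= e^mu G] is again a bound by some [D _]
    and can be fed to results about such bounds. *)
Lemma expdiag_const a c : D (a + const_mx c) = toC (expR c) *: D a.
Proof.
rewrite /expdiag scalemxAl scalemxAr -linearZ /=; congr (_ *m diag_mx _ *m _).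
by apply/matrixP => i j; rewrite !mxE expRD rmorphM mulrC.
Qed.

Lemma expdiag_half a : D a = (D (2^-1 *: a)) ^t* *m D (2^-1 *: a).
Proof. by rewrite expdiag_herm expdiagD half_add. Qed.

Lemma expdiag_psd a : psd (D a).
Proof. by rewrite expdiag_half; apply: psd_gram. Qed.

Lemma expdiag_qform_gt0 a (v : 'cV[C]_N) :
  v != 0 -> 0 < (v ^t* *m D a *m v) ord0 ord0.
Proof.
move=> nz; rewrite expdiag_half mulmxA -adjmxM -mulmxA.
apply: adjmx_self_gt0; apply: contraNN nz => /eqP h.
have := congr1 (mulmx (D (- (2^-1 *: a)))) h.
by rewrite mulmxA expdiagD addNr expdiag0 mul1mx mulmx0 => ->.
Qed.

(** The block matrix is the Gram matrix of the row of square roots [D (a/2)], [D (b/2)], whose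
    product is [D c]. *)
Lemma psd_block_expdiag a b c : c + c = a + b ->
  psd (block_mx (D a) (D c) (D c) (D b)).
Proof.
move=> habc; have h : D c = D (2^-1 *: a) *m D (2^-1 *: b).
  by rewrite expdiagD -scalerDr -habc scalerDr half_add.
have h' : D c = D (2^-1 *: b) *m D (2^-1 *: a) by rewrite expdiagD addrC -expdiagD.
have hh e : D e = D (2^-1 *: e) *m D (2^-1 *: e) by rewrite expdiagD half_add.
rewrite {1}h h' (hh a) (hh b).
exact: psd_block_gram (expdiag_herm _) (expdiag_herm _).
Qed.

(** The largest relative eigenvalue [l > 1] is written [e^mu], so that the optimal bound on [Z]
    keeps the form [D _]. *)
Lemma expdiag_top_eigenvector (Z : 'M[C]_N) g : Z ^t* = Z ->
  psd (D g - Z) \/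
  exists (mu : R) (x : 'cV[C]_N), [/\ 0 < mu, x != 0,
    psd (D (g + const_mx mu) - Z) & Z *m x = D (g + const_mx mu) *m x].
Proof.
move=> hZ; have := psd_top_eigenvector hZ (expdiag_herm (2^-1 *: g))
  (expdiag_herm (- (2^-1 *: g))).
rewrite !expdiagD subrr expdiag0 half_add => /(_ erefl) [|[l [x [l1 nz hp Zx]]]].
  by left.
have [r lr] := toC_realP (gtr0_real (lt_trans ltr01 l1)).
have r1 : 1 < r by rewrite -(leW_mono toC_le) rmorph1 -lr.
right; exists (ln r), x; rewrite expdiag_const lnK ?posrE ?(lt_trans ltr01 r1) //.
by rewrite -lr -scalemxAl; split=> //; apply: ln_gt0.
Qed.

(* The geometric mean of commuting matrices is the largest corner [Z]: test
   the block matrix on a top eigenvector of [Z] relative to the mean. *)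
Lemma psd_block_le_expdiag (Z : 'M[C]_N) a b c : c + c = a + b ->
  psd (block_mx (D a) Z Z (D b)) -> psd (D c - Z).
Proof.
move=> habc hb; have hZ := psd_block_herm hb.
have [//|[mu [x [mu0 nz _ Zx]]]] := expdiag_top_eigenvector c hZ.
rewrite expdiag_const -scalemxAl in Zx.
have mu1 : 1 < toC (expR mu).
  by rewrite -(rmorph1 toC) (leW_mono toC_le) -expR0 ltr_expR.
have hb2 : c - a = b - c.
  have -> : b = c + c - a by rewrite habc addrC addKr.
  by rewrite [RHS]addrAC addrK.
have EPE : D (b - c) *m D a *m D (b - c) = D b.
  by rewrite 2!expdiagD -{1}hb2 subrK addrC subrK.
have EG : D (b - c) *m D c = D b by rewrite expdiagD subrK.
have GE : D c *m D (b - c) = D b by rewrite expdiagD addrC subrK.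
have := psd_block_test hb (expdiag_herm c) (expdiag_herm _) EPE EG GE
  (ger0_real (ltW (lt_trans ltr01 mu1))) Zx.
have := expdiag_qform_gt0 b nz; set y := (_ ord0 ord0) => y0.
by rewrite pmulr_lge0 // subr_ge0 lt_geF.
Qed.


(** This is a Schur complement: congruence by the column of [1] and [- D (b - c)] leaves
    [T - D b (D c)^-1 D b], and [b - c + b = a]. *)
Lemma psd_block_ge_expdiag (T : 'M[C]_N) a b c : b + b = a + c ->
  psd (block_mx T (D b) (D b) (D c)) -> psd (T - D a).
Proof.
move=> habc /(@psd_congr _ _ _ (col_mx 1%:M (- D (b - c)))).
have bc : b - c = a - b.
  by apply/eqP; rewrite subr_eq addrAC eq_sym subr_eq habc.
have FB : D (b - c) *m D b = D a by rewrite expdiagD bc subrK.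
have BF : D b *m D (b - c) = D a by rewrite expdiagD addrC bc subrK.
have FCF : D (b - c) *m D c *m D (b - c) = D a by rewrite expdiagD subrK.
rewrite block_qform adjmxN adjmx1 expdiag_herm mulmx1 !mul1mx !mulNmx !mulmxN.
by rewrite mulmx1 opprK FB BF FCF addNr addr0.
Qed.

End ExpDiag.

(** * Systems of block LMIs for weighted geometric means *)

Section Systems.

(* A triple [(i, j, k)] stands for the LMI [[E i, E j], [E j, E k]] >= 0 in
   matrix variables [E]. *)
Definition block_system := seq (nat * nat * nat).

Definition system_holds (C : numClosedFieldType) N (E : nat -> 'M[C]_N)
    (sys : block_system) :=
  forall c, c \in sys ->
    psd (block_mx (E c.1.1) (E c.1.2) (E c.1.2) (E c.2)).

Definition system_vars_lt (g : nat) (sys : block_system) :=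
  all (fun c => [&& c.1.1 < g, c.1.2 < g & c.2 < g]%N) sys.

Lemma system_vars_lt_leq g g' sys :
  (g <= g')%N -> system_vars_lt g sys -> system_vars_lt g' sys.
Proof.
by move=> gg'; apply: sub_all => c /and3P[? ? ?]; apply/and3P; split; lia.
Qed.

Variables (R : realType) (C : numClosedFieldType) (toC : {rmorphism R -> C}).
Hypothesis toC_le : {mono toC : x y / x <= y}.
Hypothesis toC_realP : forall z : C, z \is Num.real -> exists x, z = toC x.

Definition wmean (V : lmodType R) (s : R) (a b : V) : V := (1 - s) *: a + s *: b.

Lemma wmean0 (V : lmodType R) (a b : V) : wmean 0 a b = a.
Proof. by rewrite /wmean subr0 scale1r scale0r addr0. Qed.

Lemma wmean1 (V : lmodType R) (a b : V) : wmean 1 a b = b.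
Proof. by rewrite /wmean subrr scale1r scale0r add0r. Qed.

(* [w j] is the weight for which [E j] is the geometric mean of weight [w j] of
   the two given matrices. *)
Definition midpoints (w : nat -> R) (sys : block_system) :=
  forall c, c \in sys -> w c.1.2 + w c.1.2 = w c.1.1 + w c.2.

Lemma eq_midpoints g w w' sys : (forall j, (j < g)%N -> w j = w' j) ->
  system_vars_lt g sys -> midpoints w sys -> midpoints w' sys.
Proof.
move=> ww' /allP lt_g mw c cs; have /and3P[? ? ?] := lt_g _ cs.
by rewrite -!ww' //; apply: mw.
Qed.

(* The variable [o] of [sys] represents the hypograph of the geometric mean of
   weight [s] of the variables [x] and [y]; the variables from [f] on, all below
   [g], are auxiliary. *)
Record mean_system (sys : block_system) (x y f g o : nat) (s : R) : Prop := {
  mean_lt : (o < g)%N;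
  mean_leq : (f <= g)%N;
  mean_vars : system_vars_lt g sys;
  mean_sound : forall N (S : 'M[C]_N) (E : nat -> 'M[C]_N) a b,
    S \is unitarymx -> system_holds E sys ->
    psd (expdiag toC S a - E x) -> psd (expdiag toC S b - E y) ->
    psd (expdiag toC S (wmean s a b) - E o);
  mean_complete : forall w0 : nat -> R, exists w, [/\
    forall j, (j < f)%N -> w j = w0 j, midpoints w sys
    & w o = (1 - s) * w x + s * w y] }.

Lemma mean_system_sym sys x y f g o s :
  mean_system sys x y f g o s -> mean_system sys y x f g o (1 - s).
Proof.
have wE (V : lmodType R) (a b : V) : wmean (1 - s) a b = wmean s b a.
  by rewrite /wmean opprB addrCA subrr addr0 addrC.
case=> ltg leg vars snd cpl; split=> //.
  by move=> N S E a b uS hE ha hb; rewrite wE; apply: snd.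
by move=> w0; have [w [? ? ?]] := cpl w0; exists w; split=> //; lra.
Qed.

(** One bisection step: the new variable [g] is the midpoint of [x] and the previous output [o], at
    the cost of one LMI. *)
Lemma mean_system_half sys x y f g o s : (x < f)%N -> (y < f)%N ->
  mean_system sys x y f g o s ->
  mean_system ((x, g, o) :: sys) x y f g.+1 g (s / 2).
Proof.
move=> xf yf [ltg leg vars snd cpl]; split; rewrite ?ltnS ?leqW //.
- apply/andP; split; last exact: system_vars_lt_leq vars.
  by apply/and3P; split=> /=; lia.
- move=> N S E a b uS hE ha hb.
  have hE' : system_holds E sys by move=> c cs; apply: hE; rewrite inE cs orbT.
  have := hE (x, g, o) (mem_head _ _).
  move=> /= /(psd_block_le ha (snd _ _ _ _ _ uS hE' ha hb)).
  apply: (psd_block_le_expdiag toC_le toC_realP uS).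
  by apply/matrixP => i j; rewrite !mxE; lra.
- move=> w0; have [w [ww0 mw wo]] := cpl w0.
  pose w' j := if j == g then (1 - s / 2) * w x + s / 2 * w y else w j.
  have w'E j : (j < g)%N -> w' j = w j.
    by rewrite /w'; case: eqP => // ->; rewrite ltnn.
  have xg : (x < g)%N by lia.
  have yg : (y < g)%N by lia.
  exists w'; split=> [j jf||].
  + by rewrite w'E ?ww0 //; lia.
  + move=> c; rewrite inE => /predU1P[->|] /=; last first.
      by apply: eq_midpoints vars mw c => j jg; rewrite w'E.
    by rewrite (w'E x) // (w'E o) // wo /w' eqxx; lra.
  + by rewrite (w'E x) // (w'E y) // /w' eqxx.
Qed.

(** Induction on the binary digits of the weight: a weight at most 1/2 is half of a coarser one, and
    a larger weight becomes so when the inputs are exchanged. *)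
Lemma dyadic_mean_system l a x y f : (a <= 2 ^ l)%N -> (x < f)%N -> (y < f)%N ->
  exists sys o, size sys = l /\
    mean_system sys x y f (f + l) o (a%:R / 2 ^+ l).
Proof.
elim: l a x y => [|l IH] a x y al xf yf.
  exists [::]; exists (if a == 0%N then x else y); split=> //.
  have [->|->] : a = 0%N \/ a = 1%N by lia.
    rewrite expr0 divr1 addn0 /=; split; [exact: xf|exact: leqnn|by []| |].
    - by move=> N S E b c uS _ hb hc; rewrite wmean0.
    - by move=> w0; exists w0; split=> //; rewrite subr0 mul1r mul0r addr0.
  rewrite expr0 divr1 addn0 /=; split; [exact: yf|exact: leqnn|by []| |].
  - by move=> N S E b c uS _ hb hc; rewrite wmean1.
  - by move=> w0; exists w0; split=> //; rewrite subrr mul1r mul0r add0r.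
have step b u v : (b <= 2 ^ l)%N -> (u < f)%N -> (v < f)%N ->
    exists sys o, size sys = l.+1 /\
      mean_system sys u v f (f + l.+1) o (b%:R / 2 ^+ l.+1).
  move=> bl uf vf; have [sys [o [sz hm]]] := IH _ _ _ bl uf vf.
  exists ((u, (f + l)%N, o) :: sys), (f + l)%N; split; first by rewrite /= sz.
  have -> : b%:R / 2 ^+ l.+1 = b%:R / 2 ^+ l / 2 :> R by rewrite exprSr invfM mulrA.
  by rewrite addnS; apply: mean_system_half.
have [al'|la] := leqP a (2 ^ l); first exact: step.
have [|sys [o [sz hm]]] := @step (2 ^ l.+1 - a)%N y x _ yf xf.
  by rewrite expnS; lia.
exists sys, o; split=> //.
have -> : a%:R / 2 ^+ l.+1 = 1 - (2 ^ l.+1 - a)%N%:R / 2 ^+ l.+1 :> R.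
  rewrite natrB // natrX mulrBl divff ?expf_neq0 ?pnatr_eq0 //; lra.
exact: mean_system_sym.
Qed.

(* With [G = A #_(p/q) B], an upper bound [Z <= e^mu G] is improved by the LMI
   [[A #_(p/2^l) B, Z], [Z, A #_(2 - q/2^l) Z]] >= 0 to [Z <= e^(r mu) G], with
   [r = 1 - q/2^(l+1) <= 1/2]; so the best [mu] is not positive. *)
Lemma rational_mean_system_low l p q x y f :
  (p <= 2 ^ l)%N -> (2 ^ l <= q)%N -> (q < 2 ^ l.+1)%N -> (x < f)%N -> (y < f)%N ->
  exists sys g o, size sys = (2 * l + 1)%N /\
    mean_system sys x y f g o (p%:R / q%:R).
Proof.
move=> pl lq ql xf yf.
have [sys1 [o1 [sz1 [lt1 le1 vars1 snd1 cpl1]]]] := dyadic_mean_system pl xf yf.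
(* The output [z] takes the first index after the variables of [sys1], and [sys2], which has [z] as
   an input, starts at [z.+1]. *)
pose z := (f + l)%N.
have xz : (x < z)%N by rewrite /z; lia.
have yz : (y < z)%N by rewrite /z; lia.
have [|||sys2 [o2 [sz2 [lt2 le2 vars2 snd2 cpl2]]]] :=
  @dyadic_mean_system l (2 ^ l.+1 - q) x z z.+1.
- by rewrite expnS; lia.
- by rewrite /z; lia.
- by [].
exists ((o1, z, o2) :: sys1 ++ sys2), (z.+1 + l)%N, z; split.
  by rewrite /= size_cat sz1 sz2; lia.
have q0 : q%:R != 0 :> R by rewrite pnatr_eq0; have := expn_gt0 2 l; lia.
have L0 : 2 ^+ l != 0 :> R by rewrite expf_neq0 // pnatr_eq0.
set s := p%:R / q%:R; set s1 := p%:R / 2 ^+ l in snd1 cpl1.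
set s2 := (2 ^ l.+1 - q)%N%:R / 2 ^+ l in snd2 cpl2.
have s1E : s1 * 2 ^+ l = p%:R by rewrite divfK.
have s2E : s2 = 2 - q%:R / 2 ^+ l.
  by rewrite /s2 natrB ?(ltnW ql) // natrX exprS mulrBl mulfK.
have s2_le1 : s2 <= 1.
  rewrite s2E; suff : 1 <= q%:R / 2 ^+ l :> R by lra.
  by rewrite ler_pdivlMr ?exprn_gt0 ?ltr0n // mul1r -natrX ler_nat.
(* The improvement is strict because [2 ^ l <= q] gives [s2 <= 1]. *)
have halved (mu : R) : 0 < mu -> s2 / 2 * mu < mu.
  by move=> mu0; rewrite -[ltRHS]mul1r (ltr_pM2r mu0); lra.
(* The weights satisfy [2 s = s1 + s2 s], whose solution [s1 / (2 - s2)] is [p / q]. Soundness and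
   completeness both rest on this. *)
have ident (X Y : R) : (1 - s) * X + s * Y + ((1 - s) * X + s * Y) =
    (1 - s1) * X + s1 * Y + ((1 - s2) * X + s2 * ((1 - s) * X + s * Y)).
  by rewrite s2E /s /s1; field; rewrite q0 L0.
have z1 : system_vars_lt (z.+1 + l) sys1.
  by apply: system_vars_lt_leq vars1; rewrite /z; lia.
split; rewrite ?/z; try lia.
- rewrite /system_vars_lt /= all_cat; apply/andP; split; last exact/andP.
  by apply/and3P; split; rewrite ?/z; lia.
- move=> N S E a b uS hE ha hb.
  have hE1 : system_holds E sys1.
    by move=> c cs; apply: hE; rewrite inE mem_cat cs orbT.
  have hE2 : system_holds E sys2.
    by move=> c cs; apply: hE; rewrite inE mem_cat cs !orbT.
  have hb0 := hE (o1, z, o2) (mem_head _ _); rewrite /= in hb0.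
  set g := wmean s a b.
  have [//|[mu [v [mu0 nz hmu Zv]]]] :=
    expdiag_top_eigenvector toC_le toC_realP uS g (psd_block_herm hb0).
  have h1 := snd1 _ _ _ _ _ uS hE1 ha hb.
  (* The input [E z] of [sys2] need not commute with the given matrices; soundness only requires the
     upper bound [hmu]. *)
  have h2 := snd2 _ _ _ _ _ uS hE2 ha hmu.
  have /(psd_block_le_expdiag toC_le toC_realP uS) := psd_block_le h1 h2 hb0.
  move=> /(_ (g + const_mx (s2 / 2 * mu))) hZ.
  have {}hZ : psd (expdiag toC S (g + const_mx (s2 / 2 * mu)) - E z).
    apply: hZ; apply/matrixP => i j; have := ident (a i j) (b i j).
    by rewrite !mxE; lra.
  (* On the eigenvector [v] the old bound is attained, so the new one would force
     [mu <= s2 / 2 * mu]. *)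
  have := psd_le_qform v hZ; rewrite -mulmxA Zv mulmxA !expdiag_const.
  rewrite -!scalemxAr -!scalemxAl.
  have := expdiag_qform_gt0 toC_le uS g nz.
  move: (v ^t* *m expdiag toC S g *m v) => Y y0.
  rewrite !mxE (ler_pM2r y0) toC_le ler_expR.
  by move=> le_mu; exfalso; move: le_mu; rewrite (lt_geF (halved mu mu0)).
- move=> w0; have [w1 [ww0 mw1 wo1]] := cpl1 w0.
  pose w1' j := if j == z then (1 - s) * w1 x + s * w1 y else w1 j.
  have w1'E j : (j < z)%N -> w1' j = w1 j.
    by rewrite /w1'; case: eqP => // ->; rewrite ltnn.
  (* Starting from [w1'] preserves the weights used by [sys1] and the weight [s] prescribed at [z],
     so the two assignments glue. *)
  have [w [ww1 mw2 wo2]] := cpl2 w1'.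
  have wE j : (j < z)%N -> w j = w1 j by move=> jz; rewrite ww1 ?w1'E // ltnW.
  have wz : w z = (1 - s) * w x + s * w y.
    by rewrite ww1 // {1}/w1' eqxx !wE //; rewrite /z; lia.
  exists w; split=> // [j jf|c].
    by rewrite wE ?ww0 //; rewrite /z; lia.
  rewrite inE mem_cat => /predU1P[->|/orP[]] /=; last exact: mw2.
    rewrite wo2 wz (wE o1) // wo1 -(wE x xz) -(wE y yz).
    exact: ident.
  by apply: eq_midpoints vars1 mw1 c => j jz; rewrite wE.
Qed.

(** Since [q < 2 ^ l.+1] for [l = trunc_log 2 q], one of [p] and [q - p] is at most [2 ^ l];
    exchanging the inputs passes from one to the other. *)
Lemma rational_mean_system p q x y f :
  (0 < q)%N -> (p <= q)%N -> (x < f)%N -> (y < f)%N ->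
  exists sys g o, size sys = (2 * trunc_log 2 q + 1)%N /\
    mean_system sys x y f g o (p%:R / q%:R).
Proof.
move=> q0 pq xf yf; set l := trunc_log 2 q.
have /andP[lq ql] := trunc_log_bounds (isT : (1 < 2)%N) q0.
have [pl|lp] := leqP p (2 ^ l); first exact: rational_mean_system_low.
have [|sys [g [o [sz hm]]]] :=
  @rational_mean_system_low l (q - p) q y x f _ lq ql yf xf.
  by move: ql; rewrite -/l expnS; lia.
exists sys, g, o; split=> //.
have -> : p%:R / q%:R = 1 - (q - p)%N%:R / q%:R :> R.
  rewrite natrB // mulrBl divff ?pnatr_eq0 -?lt0n //; lra.
exact: mean_system_sym.
Qed.

(* [[T, A], [A, A #_s B]] >= 0 says that T dominates A #_(-s) B. *)
Lemma system_epigraph_sound sys x y f g o s T N (S : 'M[C]_N) E a b :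
  mean_system sys x y f g o s -> S \is unitarymx ->
  system_holds E ((T, x, o) :: sys) ->
  E x = expdiag toC S a -> E y = expdiag toC S b ->
  psd (E T - expdiag toC S (wmean (- s) a b)).
Proof.
case=> ltg leg vars snd cpl uS hE ha hb.
have hE' : system_holds E sys by move=> c cs; apply: hE; rewrite inE cs orbT.
have ho : psd (expdiag toC S (wmean s a b) - E o).
  by apply: snd => //; rewrite ?ha ?hb subrr; apply: psd0.
have := hE (T, x, o) (mem_head _ _) => /= hb0.
have hT : psd (E T - E T) by rewrite subrr; apply: psd0.
have := psd_block_le hT ho hb0; rewrite ha.
apply: (psd_block_ge_expdiag toC_le uS).
by apply/matrixP => i j; rewrite !mxE; lra.
Qed.

End Systems.

(** * Left and right multiplication operators *)

Section UnitaryDiag.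
Variables (C : numClosedFieldType) (n : nat) (U : 'M[C]_n).
Hypothesis unitU : U \is unitarymx.

Lemma unitary_adj_delta_neq0 i : U ^t* *m delta_mx i (ord0 : 'I_1) != 0.
Proof.
apply/eqP => /(congr1 (mulmx U)).
rewrite mulmxA unitary_mulmx_adj // mul1mx mulmx0.
by move/matrixP => /(_ i ord0); rewrite !mxE !eqxx => /eqP; rewrite oner_eq0.
Qed.

(** Evaluating the form at an eigenvector isolates one eigenvalue, so positive definiteness makes
    the spectrum positive. *)
Lemma unitary_diag_qform (d : 'rV[C]_n) i (v := U ^t* *m delta_mx i (ord0 : 'I_1)) :
  (v ^t* *m (U ^t* *m diag_mx d *m U) *m v) ord0 ord0 = d ord0 i.
Proof.
rewrite /v adjmxM trmxCK !mulmxA -(mulmxA _ U) unitary_mulmx_adj // mulmx1.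
rewrite -(mulmxA _ U) unitary_mulmx_adj // mulmx1.
by rewrite -colE mxE mul_mx_diag !mxE !eqxx rmorph1 mul1r.
Qed.

End UnitaryDiag.

Lemma expdiag_diag (R : realType) (C : numClosedFieldType)
    (toC : {rmorphism R -> C}) n (U : 'M[C]_n) (x : 'rV[R]_n)
    (d : 'rV[C]_n) :
  (forall i, d ord0 i = toC (expR (x ord0 i))) ->
  U ^t* *m diag_mx d *m U = expdiag toC U x.
Proof.
move=> dE; congr (_ *m diag_mx _ *m _).
by apply/rowP => i; rewrite dE mxE.
Qed.

Section MulOperators.
Variable C : numClosedFieldType.
Variables n m : nat.
Implicit Types (A : 'M[C]_n) (B : 'M[C]_m) (Y : 'M[C]_(n, m)).

(* The matrices of [Y |-> A *m Y] and [Y |-> Y *m B] in the entries of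
   [Y : 'M_(n, m)], i.e. the Kronecker products of [A] with 1 and of 1 with the
   transpose of [B]. *)
Definition lmul_op A : 'M[C]_(n * m) := (lin_mulmx A)^T.
Definition rmul_op B : 'M[C]_(n * m) := (lin_mulmxr B)^T.
Definition vec_col Y : 'cV[C]_(n * m) := (mxvec Y)^T.

Lemma lmul_opE A Y : lmul_op A *m vec_col Y = vec_col (A *m Y).
Proof. by rewrite /lmul_op /vec_col -trmx_mul mul_vec_lin. Qed.

Lemma rmul_opE B Y : rmul_op B *m vec_col Y = vec_col (Y *m B).
Proof. by rewrite /rmul_op /vec_col -trmx_mul mul_vec_lin. Qed.

(** Operators are compared by their action on matrices [Y], which reduces Kronecker identities to
    associativity of the product. *)
Lemma eq_op_vec_col (M M' : 'M[C]_(n * m)) :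
  (forall Y, M *m vec_col Y = M' *m vec_col Y) -> M = M'.
Proof.
move=> h; apply: trmx_inj; apply/row_matrixP => i; rewrite !rowE.
have := h (vec_mx (delta_mx 0 i)); rewrite /vec_col vec_mxK.
by move/(congr1 trmx); rewrite !trmx_mul !trmxK.
Qed.

Lemma lmul_opM A A' : lmul_op (A *m A') = lmul_op A *m lmul_op A'.
Proof. by apply: eq_op_vec_col => Y; rewrite -mulmxA !lmul_opE mulmxA. Qed.

Lemma rmul_opM B B' : rmul_op (B *m B') = rmul_op B' *m rmul_op B.
Proof. by apply: eq_op_vec_col => Y; rewrite -mulmxA !rmul_opE mulmxA. Qed.

Lemma lrmul_opC A B : lmul_op A *m rmul_op B = rmul_op B *m lmul_op A.
Proof.
by apply: eq_op_vec_col => Y; rewrite -!mulmxA !(lmul_opE, rmul_opE) mulmxA.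
Qed.

Lemma lmul_op1 : lmul_op 1%:M = 1%:M.
Proof. by apply: eq_op_vec_col => Y; rewrite lmul_opE !mul1mx. Qed.

Lemma rmul_op1 : rmul_op 1%:M = 1%:M.
Proof. by apply: eq_op_vec_col => Y; rewrite rmul_opE mul1mx mulmx1. Qed.

Lemma lmul_opZD c A A' : lmul_op (c *: A + A') = c *: lmul_op A + lmul_op A'.
Proof. by rewrite /lmul_op !linearP. Qed.

Lemma rmul_opZD c B B' : rmul_op (c *: B + B') = c *: rmul_op B + rmul_op B'.
Proof. by rewrite /rmul_op !linearP. Qed.

Lemma vec_col_dot Y Y' :
  ((vec_col Y) ^t* *m vec_col Y') ord0 ord0 = \tr (Y ^t* *m Y').
Proof.
rewrite /vec_col trmxK mxE /mxtrace.
under [RHS]eq_bigr => j _ do rewrite mxE.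
rewrite exchange_big pair_bigA /=.
rewrite (reindex _ (curry_mxvec_bij n m)) /=.
by apply: eq_bigr => -[i j] _; rewrite !mxE !mxvecE.
Qed.

Lemma lmul_op_entry A i j k l :
  lmul_op A (mxvec_index i j) (mxvec_index k l) = A i k *+ (j == l).
Proof.
rewrite /lmul_op !mxE /= vec_mx_delta mxvecE mxE (bigD1 k) //= mxE eqxx /=.
by rewrite big1 ?addr0 ?mulr_natr // => r /negPf rk; rewrite mxE rk mulr0.
Qed.

Lemma rmul_op_entry B i j k l :
  rmul_op B (mxvec_index i j) (mxvec_index k l) = B l j *+ (i == k).
Proof.
rewrite /rmul_op !mxE /= vec_mx_delta mxvecE mxE (bigD1 l) //= mxE eqxx andbT.
rewrite big1 ?addr0 ?mulr_natl // => r /negPf rk.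
by rewrite mxE rk andbF mul0r.
Qed.

Lemma lmul_op_adj A : (lmul_op A) ^t* = lmul_op (A ^t*).
Proof.
apply/matrixP => I J; case/mxvec_indexP: I => i j; case/mxvec_indexP: J => k l.
transitivity (Num.conj (lmul_op A (mxvec_index k l) (mxvec_index i j))).
  by rewrite 2!mxE.
by rewrite !lmul_op_entry !mxE rmorphMn eq_sym.
Qed.

Lemma rmul_op_adj B : (rmul_op B) ^t* = rmul_op (B ^t*).
Proof.
apply/matrixP => I J; case/mxvec_indexP: I => i j; case/mxvec_indexP: J => k l.
transitivity (Num.conj (rmul_op B (mxvec_index k l) (mxvec_index i j))).
  by rewrite 2!mxE.
by rewrite !rmul_op_entry !mxE rmorphMn eq_sym.
Qed.

Lemma diag_lrmul_op (x : 'rV[C]_n) (y : 'rV[C]_m) :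
  diag_mx (mxvec (\matrix_(i, j) (x ord0 i * y ord0 j)))
    = lmul_op (diag_mx x) *m rmul_op (diag_mx y).
Proof.
apply: eq_op_vec_col => Y; rewrite -mulmxA rmul_opE lmul_opE /vec_col.
apply/matrixP => I j; rewrite mul_diag_mx !mxE (ord1 j).
case/mxvec_indexP: I => k l; rewrite !mxvecE mul_diag_mx mul_mx_diag !mxE.
by rewrite mulrAC mulrA.
Qed.

Variables (U : 'M[C]_n) (V : 'M[C]_m).
Hypotheses (unitU : U \is unitarymx) (unitV : V \is unitarymx).

(** The operator [Y |-> U *m Y *m V ^t*], which diagonalizes simultaneously the left multiplications
    diagonal in [U] and the right multiplications diagonal in [V]. *)
Definition lrmul_basis := lmul_op U *m rmul_op (V ^t*).

Lemma lrmul_basis_unitary : lrmul_basis \is unitarymx.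
Proof.
apply/unitarymxP; rewrite /lrmul_basis adjmxM lmul_op_adj rmul_op_adj trmxCK.
rewrite !mulmxA -(mulmxA (lmul_op U)) -rmul_opM unitary_mulmx_adj // rmul_op1.
by rewrite mulmx1 -lmul_opM unitary_mulmx_adj // lmul_op1.
Qed.

Lemma lrmul_basis_diag (x : 'rV[C]_n) (y : 'rV[C]_m) :
  lrmul_basis ^t* *m diag_mx (mxvec (\matrix_(i, j) (x ord0 i * y ord0 j)))
    *m lrmul_basis
  = lmul_op (U ^t* *m diag_mx x *m U) *m rmul_op (V ^t* *m diag_mx y *m V).
Proof.
rewrite diag_lrmul_op /lrmul_basis adjmxM lmul_op_adj rmul_op_adj trmxCK.
rewrite !lmul_opM !rmul_opM !mulmxA.
rewrite -(lrmul_opC (U ^t*) V) -(mulmxA _ (rmul_op V) (lmul_op (diag_mx x))).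
rewrite -lrmul_opC -(mulmxA _ (rmul_op (diag_mx y)) (lmul_op U)) -lrmul_opC.
by rewrite !mulmxA -(mulmxA _ (rmul_op V) (lmul_op U)) -lrmul_opC !mulmxA.
Qed.

Variables (R : realType) (toC : {rmorphism R -> C}).
Local Notation E := (expdiag toC).

Lemma expdiag_lrmul_basis (x : 'rV[R]_n) (y : 'rV[R]_m) :
  lmul_op (E U x) *m rmul_op (E V y)
    = E lrmul_basis (mxvec (\matrix_(i, j) (x ord0 i + y ord0 j))).
Proof.
rewrite /expdiag -lrmul_basis_diag; congr (_ *m diag_mx _ *m _).
apply/rowP => I; case/mxvec_indexP: I => i j.
by rewrite [RHS]mxE !mxvecE !mxE expRD rmorphM.
Qed.

(** Left multiplication by [E U x] has eigenvalue [e^(x_i)] at index [(i, j)] for every [j];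
    [col_log] is the counterpart for right multiplication. *)
Definition row_log (x : 'rV[R]_n) : 'rV[R]_(n * m) :=
  mxvec (\matrix_(i, j) x ord0 i).
Definition col_log (y : 'rV[R]_m) : 'rV[R]_(n * m) :=
  mxvec (\matrix_(i, j) y ord0 j).

Lemma lmul_op_expdiag x : lmul_op (E U x) = E lrmul_basis (row_log x).
Proof.
have := expdiag_lrmul_basis x 0; rewrite (expdiag0 toC unitV) rmul_op1 mulmx1 => ->.
by congr (E _ (mxvec _)); apply/matrixP => i j; rewrite !mxE addr0.
Qed.

Lemma rmul_op_expdiag y : rmul_op (E V y) = E lrmul_basis (col_log y).
Proof.
have := expdiag_lrmul_basis 0 y; rewrite (expdiag0 toC unitU) lmul_op1 mul1mx => ->.
by congr (E _ (mxvec _)); apply/matrixP => i j; rewrite !mxE add0r.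
Qed.

(** The trace is the inner product of [K] with [A^(1-t) K B^t], and this operator on [K] has the
    logarithms [(1 - t) x_i + t y_j]. *)
Lemma lieb_expdiag (K : 'M[C]_(n, m)) t x y :
  \tr (K ^t* *m E U ((1 - t) *: x) *m K *m E V (t *: y))
    = ((vec_col K) ^t* *m E lrmul_basis (wmean t (row_log x) (col_log y))
       *m vec_col K) ord0 ord0.
Proof.
have -> : wmean t (row_log x) (col_log y)
    = mxvec (\matrix_(i, j) (((1 - t) *: x) ord0 i + (t *: y) ord0 j)).
  rewrite /wmean -!linearZ -linearD; congr mxvec.
  by apply/matrixP => i j; rewrite !mxE.
rewrite -expdiag_lrmul_basis -[in RHS]mulmxA -(mulmxA (lmul_op _)) rmul_opE lmul_opE.
by rewrite vec_col_dot !mulmxA.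
Qed.

End MulOperators.

(** * Spectral calculus over the complex numbers *)

Section Complex.
Variable R : realType.

Lemma real_complex_le : {mono real_complex R : x y / x <= y}.
Proof. by move=> x y; rewrite lecR. Qed.

Lemma real_complex_realP (z : R[i]) : z \is Num.real -> exists x : R, z = x%:C.
Proof. by move/complex_realP. Qed.

Lemma conj_real_complex (c : R) : Num.conj c%:C = c%:C :> R[i].
Proof. by apply/CrealP/complex_realP; exists c. Qed.

Lemma psdmxE n (X : 'M[R[i]]_n) : psdmx X <-> psd X.
Proof. by split=> -[/hermsymP hX pX]; split=> //; apply/hermsymP. Qed.

Lemma pd_expdiag n (A : 'M[R[i]]_n) : pdmx A ->
  exists (U : 'M[R[i]]_n) (x : 'rV[R]_n),
  [/\ U \is unitarymx, A = expdiag (real_complex R) U x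
    & forall s, pdpow A s = expdiag (real_complex R) U (s *: x)].
Proof.
move=> [hA pA]; set U := spectralmx A; set d := spectral_diag A.
have uU : U \is unitarymx by apply: spectral_unitarymx.
have AE : A = U ^t* *m diag_mx d *m U.
  by rewrite -invmx_unitary //; apply/orthomx_spectralP/hermitian_normalmx.
have dE i : exists2 r : R, 0 < r & d ord0 i = r%:C.
  have qE := unitary_diag_qform uU d i; rewrite -AE in qE.
  have d0 := pA _ (unitary_adj_delta_neq0 uU i); rewrite qE in d0.
  have [r dr] := real_complex_realP (gtr0_real d0).
  by exists r => //; rewrite -ltcR -dr.
exists U, (\row_i ln (complex.Re (d ord0 i))); split=> [//||s].
  rewrite {1}AE; apply: expdiag_diag => i; rewrite mxE.
  by have [r r0 ->] := dE i; rewrite lnK.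
rewrite /pdpow -/U -/d.
rewrite (invmx_unitary uU).
apply: expdiag_diag => i.
rewrite !mxE.
(* [powR] has a separate value at base 0; [r0] selects the branch [expR (s * ln r)]. *)
by have [r r0 ->] := dE i; rewrite /powR /= gt_eqF.
Qed.

Lemma lieb_trace_expdiag n m (A : 'M[R[i]]_n) (B : 'M[R[i]]_m) :
  pdmx A -> pdmx B ->
  exists (S : 'M[R[i]]_(n * m)) (a b : 'rV[R]_(n * m)),
  [/\ S \is unitarymx, lmul_op m A = expdiag (real_complex R) S a,
      rmul_op n B = expdiag (real_complex R) S b
    & forall (K : 'M[R[i]]_(n, m)) t, lieb_trace K t A B
        = ((vec_col K) ^t* *m expdiag (real_complex R) S (wmean t a b)
           *m vec_col K) ord0 ord0].
Proof.
move=> /pd_expdiag [U [x [uU AE powA]]] /pd_expdiag [V [y [uV BE powB]]].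
exists (lrmul_basis U V), (row_log m x), (col_log n y); split.
- exact: lrmul_basis_unitary.
- by rewrite AE; apply: lmul_op_expdiag.
- by rewrite BE; apply: rmul_op_expdiag.
- by move=> K t; rewrite /lieb_trace powA powB; apply: lieb_expdiag.
Qed.

End Complex.

(** * LMIs from real-linear matrix maps *)

Section RealLinear.
Variables (R : realType) (C : numClosedFieldType) (toC : {rmorphism R -> C}).
Hypothesis toC_le : {mono toC : x y / x <= y}.

Let conj_toC c : Num.conj (toC c) = toC c.
Proof.
apply/CrealP; have [c0|c0] := leP 0 c.
  by apply: ger0_real; rewrite -(rmorph0 toC) toC_le.
by apply: ler0_real; rewrite -(rmorph0 toC) toC_le ltW.
Qed.

Definition real_linear d s s' (f : 'rV[R]_d -> 'M[C]_(s, s')) :=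
  forall c x y, f (c *: x + y) = toC c *: f x + f y.

Lemma real_linear_sum d s s' (f : 'rV[R]_d -> 'M[C]_(s, s')) x :
  real_linear f -> f x = \sum_j toC (x ord0 j) *: f (delta_mx ord0 j).
Proof.
move=> lf; have f0 : f 0 = 0.
  by have := lf (-1) 0 0; rewrite scaler0 addr0 rmorphN1 scaleN1r addNr.
rewrite {1}(row_sum_delta x).
apply: (big_rec2 (fun u w => f u = w)) => // j u w _ <-.
exact: lf.
Qed.

Definition herm_part s (X : 'M[C]_s) := 2^-1 *: (X + X ^t*).

Lemma herm_part_herm s (X : 'M[C]_s) : (herm_part X) ^t* = herm_part X.
Proof.
have h : Num.conj (2^-1 : C) = 2^-1.
  by apply/CrealP/ger0_real; rewrite invr_ge0 ler0n.
by rewrite /herm_part adjmxZ adjmxD trmxCK addrC h.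
Qed.

Lemma herm_part_id s (X : 'M[C]_s) : X ^t* = X -> herm_part X = X.
Proof.
move=> hX; rewrite /herm_part hX -mulr2n -scaler_nat scalerA.
by rewrite mulVf ?scale1r ?pnatr_eq0.
Qed.

(** The adjoint is only conjugate-linear over [C], but conjugation fixes the scalars [toC c]. *)
Lemma real_linear_herm_part d s (f : 'rV[R]_d -> 'M[C]_s) :
  real_linear f -> real_linear (fun x => herm_part (f x)).
Proof.
move=> lf c x y; rewrite /herm_part lf adjmxD adjmxZ conj_toC addrACA -scalerDr.
by rewrite [LHS]scalerDr scalerA [_ * toC c]mulrC -scalerA.
Qed.

Lemma real_linear_block d s (f g h : 'rV[R]_d -> 'M[C]_s) :
  real_linear f -> real_linear g -> real_linear h ->
  real_linear (fun x => block_mx (f x) (g x) (g x) (h x)).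
Proof.
by move=> lf lg lh c x y; rewrite lf lg lh scale_block_mx add_block_mx.
Qed.

Definition mx_of_coord n (v : 'rV[R]_(n * n + n * n)) : 'M[C]_n :=
  map_mx toC (vec_mx (lsubmx v)) + 'i *: map_mx toC (vec_mx (rsubmx v)).

Lemma real_linear_mx_of_coord n : real_linear (@mx_of_coord n).
Proof.
move=> c x y; rewrite /mx_of_coord !linearP /= !map_mxD !map_mxZ.
rewrite scalerDr addrACA; congr (_ + _).
by rewrite [RHS]scalerDr !scalerA ['i * _]mulrC.
Qed.

Variables (n m k : nat).
Local Notation d := ((n * n + n * n) + (m * m + m * m) + 1)%N.
Local Notation N := (n * m)%N.
Local Notation point := 'rV[R]_(d + k * (N * N + N * N)).

(* Variables 0 and 1 are the two given matrices; the next [k] are read off the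
   lifting variables.  [herm_part] is the identity where it matters and makes
   every coefficient Hermitian. *)
Definition system_env (z : point) (j : nat) : 'M[C]_N :=
  match j with
  | 0 => lmul_op m (herm_part (mx_of_coord (lsubmx (lsubmx (lsubmx z)))))
  | 1 => rmul_op n (herm_part (mx_of_coord (rsubmx (lsubmx (lsubmx z)))))
  | j.+2 => if insub j is Some i
            then herm_part (mx_of_coord (row i (vec_mx (rsubmx z)))) else 0
  end.

Lemma real_linear_system_env j : real_linear (system_env ^~ j).
Proof.
case: j => [|[|j]] c x y /=.
- by rewrite !linearP (real_linear_herm_part (@real_linear_mx_of_coord n)) lmul_opZD.
- by rewrite !linearP (real_linear_herm_part (@real_linear_mx_of_coord m)) rmul_opZD.
case: insub => [i|]; last by rewrite scaler0 addr0.
by rewrite !linearP (real_linear_herm_part (@real_linear_mx_of_coord _)).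
Qed.

Lemma system_env_herm z j : (system_env z j) ^t* = system_env z j.
Proof.
case: j => [|[|j]] /=.
- by rewrite lmul_op_adj herm_part_herm.
- by rewrite rmul_op_adj herm_part_herm.
case: insub => [i|]; first exact: herm_part_herm.
by rewrite trmx0 map_mx0.
Qed.

(** The scalar inequality as a 1 x 1 matrix: the sign [e] is 1 for hypographs and -1 for
    epigraphs. *)
Definition system_bound (e : R) (v : 'cV[C]_N) (o : nat) (z : point) : 'M[C]_1 :=
  toC e *: (v ^t* *m system_env z o *m v
            - (toC (rsubmx (lsubmx z) ord0 ord0))%:M).

Lemma system_boundE e v o z : (system_bound e v o z) ord0 ord0
  = toC e * ((v ^t* *m system_env z o *m v) ord0 ord0
             - toC (rsubmx (lsubmx z) ord0 ord0)).
Proof.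
rewrite /system_bound; move: (v ^t* *m _ *m v) => Y.
by rewrite !mxE eqxx mulr1n.
Qed.

Lemma real_linear_system_bound e v o : real_linear (system_bound e v o).
Proof.
move=> c x y; rewrite /system_bound (real_linear_system_env o c).
have -> : rsubmx (lsubmx (c *: x + y)) ord0 ord0 = c * rsubmx (lsubmx x) ord0 ord0
    + rsubmx (lsubmx y) ord0 ord0.
  by rewrite !mxE.
rewrite mulmxDr mulmxDl -scalemxAr -scalemxAl rmorphD rmorphM.
rewrite (raddfD (@scalar_mx C 1)) /= -scale_scalar_mx opprD addrACA -scalerBr.
by rewrite scalerDr !scalerA [toC e * _]mulrC.
Qed.

Lemma system_bound_herm e v o z : (system_bound e v o z) ^t* = system_bound e v o z.
Proof.
rewrite /system_bound adjmxZ adjmxD adjmxN !adjmxM trmxCK system_env_herm mulmxA.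
rewrite conj_toC tr_scalar_mx map_scalar_mx; congr (_ *: (_ - _%:M)).
exact: conj_toC.
Qed.

End RealLinear.

Lemma psd_mx11 (C : numClosedFieldType) (X : 'M[C]_1) :
  X ^t* = X -> psd X <-> 0 <= X ord0 ord0.
Proof.
move=> hX; split=> [[_ /(_ 1%:M)]|X0]; first by rewrite adjmx1 mul1mx mulmx1.
split=> // v; rewrite !(mxE, big_ord1) !ord1 mulrAC mulr_ge0 //.
by rewrite mulrC mul_conjC_ge0.
Qed.

Lemma eq_system_holds (C : numClosedFieldType) N (E E' : nat -> 'M[C]_N) g sys :
  (forall j, (j < g)%N -> E j = E' j) -> system_vars_lt g sys ->
  system_holds E sys -> system_holds E' sys.
Proof.
move=> EE' /allP lt_g hE c cs; have /and3P[h1 h2 h3] := lt_g _ cs.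
by rewrite -(EE' _ h1) -(EE' _ h2) -(EE' _ h3); apply: hE.
Qed.

(** Midpoint relations between weights become midpoint relations between logarithms, so exact means
    satisfy every LMI of the system. *)
Lemma midpoints_system_holds (R : realType) (C : numClosedFieldType)
    (toC : {rmorphism R -> C}) N (S : 'M[C]_N) a b w sys :
  {mono toC : x y / x <= y} -> S \is unitarymx -> midpoints w sys ->
  system_holds (fun j => expdiag toC S (wmean (w j) a b)) sys.
Proof.
move=> toC_le uS mw c cs; apply: psd_block_expdiag => //.
apply/matrixP => i j; have := mw c cs; rewrite !mxE => h.
have -> : w c.2 = w c.1.2 + w c.1.2 - w c.1.1 by rewrite h addrC addKr.
ring.
Qed.

Lemma eq_expdiag (R : realType) (C : numClosedFieldType)
    (toC : {rmorphism R -> C}) N (S : 'M[C]_N) a b :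
  a = b -> expdiag toC S a = expdiag toC S b.
Proof. by move=> ->. Qed.

Lemma mx_of_coordK (R : realType) n (A : 'M[R[i]]_n) :
  mx_of_coord (real_complex R) (mx_coord A) = A.
Proof.
rewrite /mx_of_coord /mx_coord row_mxKl row_mxKr !mxvecK; apply/matrixP => i j.
by rewrite !mxE -complexiE -complexE.
Qed.

Lemma lmi_of_real_linear (R : realType) d s (f : 'rV[R]_d -> 'M[R[i]]_s) :
  real_linear (real_complex R) f -> (forall x, (f x) ^t* = f x) ->
  exists L : lmi R d, lmi_size L = s /\ forall x, lmi_holds x L <-> psd (f x).
Proof.
move=> lf hf; have h0 : (0 : 'M[R[i]]_s) \is hermsymmx.
  by apply/hermsymP; rewrite trmx0 map_mx0.
have hc j : f (delta_mx ord0 j) \is hermsymmx by apply/hermsymP/hf.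
exists (Lmi h0 hc); split=> [|x]; first by [].
by rewrite /lmi_holds /= add0r (real_linear_sum x lf); apply: psdmxE.
Qed.

Lemma lmis_of_real_linear (R : realType) (T : eqType) d s
    (F : T -> 'rV[R]_d -> 'M[R[i]]_s) (cs : seq T) :
  (forall c, real_linear (real_complex R) (F c)) ->
  (forall c x, (F c x) ^t* = F c x) ->
  exists Ls : seq (lmi R d), [seq lmi_size L | L <- Ls] = nseq (size cs) s /\
    forall x, List.Forall (lmi_holds x) Ls <-> forall c, c \in cs -> psd (F c x).
Proof.
move=> lF hF; elim: cs => [|c cs [Ls [szLs LsP]]].
  by exists [::]; split=> // x; split=> // _; constructor.
have [L [szL LP]] := lmi_of_real_linear (lF c) (hF c).
exists (L :: Ls); split=> [|x]; first by rewrite /= szL szLs.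
rewrite List.Forall_cons_iff LP LsP; split=> [[hc hcs] c'|h].
  by rewrite inE => /predU1P[->|/hcs].
by split=> [|c' cs']; apply: h; rewrite inE ?eqxx ?cs' ?orbT.
Qed.

Section SystemRepresentation.
Variables (R : realType) (n m : nat) (K : 'M[R[i]]_(n, m)).
Local Notation N := (n * m)%N.
Local Notation D := (expdiag (real_complex R)).

(** Turns existence of matrices solving a block system into existence of real lifting variables,
    namely the coordinates of these matrices. *)
Lemma sdp_of_system (e : R) (sys : block_system) g o S :
  system_vars_lt g sys -> (o < g)%N ->
  (forall x, @pd_domain R n m x -> S x <->
    exists E : nat -> 'M[R[i]]_N,
      [/\ E 0%N = lmul_op m x.1.1, E 1%N = rmul_op n x.1.2,
          forall j, (E j) ^t* = E j, system_holds E sys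
        & 0 <= e%:C * (((vec_col K) ^t* *m E o *m vec_col K) ord0 ord0
                       - x.2%:C)]) ->
  sdp_representation (@triple_coord R n m) (@pd_domain R n m) S
    (nseq (size sys) (2 * N)%N ++ [:: N; 1%N]).
Proof.
move=> vars og SP.
pose env := @system_env R R[i] (real_complex R) n m g.
pose F (c : nat * nat * nat) z :=
  block_mx (env z c.1.1) (env z c.1.2) (env z c.1.2) (env z c.2).
have lenv j : real_linear (real_complex R) (env ^~ j).
  exact: (@real_linear_system_env R R[i] (real_complex R) (@real_complex_le R)).
have henv z j : (env z j) ^t* = env z j by apply: system_env_herm.
have [|c z|Ls [szLs LsP]] := @lmis_of_real_linear R _ _ _ F sys.
- by move=> c; apply: real_linear_block.
- by rewrite adjmx_block !henv.
(* The LMI of size [N] is taken to be [0 >= 0], which always holds. *)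
have [|_|L0 [szL0 L0P]] :=
  @lmi_of_real_linear R (((n * n + n * n) + (m * m + m * m) + 1)
    + g * (N * N + N * N)) N (fun=> 0).
- by move=> c x y; rewrite scaler0 addr0.
- by rewrite trmx0 map_mx0.
have [z|L1 [szL1 L1P]] := lmi_of_real_linear
  (real_linear_system_bound (@real_complex_le R) (k := g) e (vec_col K) o).
- exact: (system_bound_herm (@real_complex_le R)).
exists (g * (N * N + N * N))%N, (Ls ++ [:: L0; L1]); split.
  by rewrite map_cat szLs /= szL0 szL1 mul2n -addnn.
move=> x Dx; rewrite SP //; have [/hermsymP hA _] := Dx.1.
have [/hermsymP hB _] := Dx.2.
have env0 y : env (row_mx (triple_coord x) y) 0%N = lmul_op m x.1.1.
  rewrite /env /system_env /triple_coord !row_mxKl mx_of_coordK.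
  by rewrite herm_part_id.
have env1 y : env (row_mx (triple_coord x) y) 1%N = rmul_op n x.1.2.
  rewrite /env /system_env /triple_coord !row_mxKl row_mxKr mx_of_coordK.
  by rewrite herm_part_id.
have boundE y : system_bound (real_complex R) e (vec_col K) o
    (row_mx (triple_coord x) y) ord0 ord0
  = e%:C * (((vec_col K) ^t* *m env (row_mx (triple_coord x) y) o
             *m vec_col K) ord0 ord0 - x.2%:C).
  rewrite system_boundE; congr (_ * (_ - _%:C)).
  by rewrite /triple_coord row_mxKl row_mxKr mxE.
have LsE y : List.Forall (lmi_holds (row_mx (triple_coord x) y)) (Ls ++ [:: L0; L1])
    <-> system_holds (env (row_mx (triple_coord x) y)) sys /\
        0 <= e%:C * (((vec_col K) ^t* *m env (row_mx (triple_coord x) y) o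
             *m vec_col K) ord0 ord0 - x.2%:C).
  rewrite List.Forall_app !List.Forall_cons_iff LsP L0P L1P -boundE.
  rewrite psd_mx11; last first.
    exact: (system_bound_herm (@real_complex_le R)).
  split=> [[? [_ []]]//|[? ?]]; split=> //; split; first exact: psd0.
  by split=> //; constructor.
split=> [[E [E0 E1 hE sysE boundEo]]|[y /LsE [hsys hbound]]]; last first.
  by exists (env (row_mx (triple_coord x) y)); split.
(* The shift by 2 matches [system_env], where indices 0 and 1 are the given matrices; [g] rows cover
   all indices below [g]. *)
exists (mxvec (\matrix_(i < g) mx_coord (E i.+2))); apply/LsE.
set z := row_mx _ _.
have envE j : (j < g)%N -> E j = env z j.
  case: j => [|[|j]] jg; rewrite ?env0 ?env1 //.
  have jg' : (j < g)%N by lia.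
  rewrite /env /= insubT /= /z row_mxKr mxvecK rowK mx_of_coordK.
  by rewrite herm_part_id.
split; first exact: eq_system_holds envE vars sysE.
by rewrite -envE.
Qed.

End SystemRepresentation.

(** * The representations *)

Section LiebRepresentation.
Variables (R : realType) (n m : nat) (K : 'M[R[i]]_(n, m)).
Local Notation N := (n * m)%N.
Local Notation D := (expdiag (real_complex R)).

Lemma hypograph_sdp (sys : block_system) g o t :
  mean_system (real_complex R) sys 0 1 2 g o t ->
  sdp_representation (@triple_coord R n m) (@pd_domain R n m)
    (hypograph (lieb_trace K t)) (nseq (size sys) (2 * N)%N ++ [:: N; 1%N]).
Proof.
move=> hmean; have [ltg _ vars snd cpl] := hmean.
apply: (@sdp_of_system R n m K 1 sys g o _ vars ltg) => -[[A B] tau] [/= pA pB].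
have [S [a [b [uS PA QB F]]]] := lieb_trace_expdiag pA pB.
rewrite PA QB rmorph1; split=> [[_ _ /= hF]|[E [E0 E1 hE sysE]]].
  (* Weights 0 and 1 stand for the two given matrices themselves, so the output receives weight
     [t]. *)
  have [w [w01 mw wo]] := cpl (fun j => if j == 1%N then 1 else 0).
  have w0 : w 0%N = 0 := w01 0%N isT.
  have w1 : w 1%N = 1 := w01 1%N isT.
  exists (fun j => D S (wmean (w j) a b)); split.
  - by apply: eq_expdiag; rewrite w0 wmean0.
  - by apply: eq_expdiag; rewrite w1 wmean1.
  - by move=> j; apply: (expdiag_herm (@real_complex_le R)).
  - exact: midpoints_system_holds (@real_complex_le R) uS mw.
  have -> : w o = t by rewrite wo w0 w1 mulr0 add0r mulr1.
  by rewrite mul1r subr_ge0 -F.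
rewrite mul1r subr_ge0 => hbound; split=> //=; apply: le_trans hbound _.
rewrite F; apply: psd_le_qform; apply: snd => //.
  by rewrite E0 subrr; apply: psd0.
by rewrite E1 subrr; apply: psd0.
Qed.

(** The first case covers [[-1, 0]]; the second covers [[1, 2]], since the mean of weight [1 + s] is
    that of weight [- s] with the inputs exchanged. *)
Lemma epigraph_sdp (sys : block_system) x y g o s t :
  (x, y, t) = (0%N, 1%N, - s) \/ (x, y, t) = (1%N, 0%N, 1 + s) ->
  mean_system (real_complex R) sys x y 2 g o s ->
  sdp_representation (@triple_coord R n m) (@pd_domain R n m)
    (epigraph (lieb_trace K t)) (nseq (size sys).+1 (2 * N)%N ++ [:: N; 1%N]).
Proof.
move=> xyt hmean; have [ltg le2g vars _ cpl] := hmean.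
have x2 : (x < 2)%N by case: xyt => -[-> _ _].
have xg : (x < g)%N by apply: leq_trans le2g.
have vars' : system_vars_lt g.+1 ((g, x, o) :: sys).
  apply/andP; split; last exact: system_vars_lt_leq vars.
  by apply/and3P; split=> /=; lia.
apply: (@sdp_of_system R n m K (-1) _ _ _ _ vars' (ltnSn g)).
move=> -[[A B] tau] [/= pA pB].
have [S [a [b [uS PA QB F]]]] := lieb_trace_expdiag pA pB.
rewrite PA QB rmorphN1; split=> [[_ _ /= hF]|[E [E0 E1 hE sysE]]].
  have [w [w01 mw wo]] := cpl (fun j => if j == 1%N then 1 else 0).
  have w0 : w 0%N = 0 := w01 0%N isT.
  have w1 : w 1%N = 1 := w01 1%N isT.
  (* The new variable [g] bounds the mean from above; at the exact mean, of weight [t], the added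
     LMI is again a midpoint relation. *)
  pose w' j := if j == g then t else w j.
  have w'E j : (j < g)%N -> w j = w' j.
    by rewrite /w'; case: eqP => // ->; rewrite ltnn.
  have w'g : w' g = t by rewrite /w' eqxx.
  exists (fun j => D S (wmean (w' j) a b)); split.
  - by apply: eq_expdiag; rewrite -w'E ?w0 ?wmean0 //; apply: leq_trans le2g.
  - by apply: eq_expdiag; rewrite -w'E ?w1 ?wmean1.
  - by move=> j; apply: (expdiag_herm (@real_complex_le R)).
  - apply: midpoints_system_holds (@real_complex_le R) uS _ => c.
    rewrite inE => /predU1P[->|]; last exact: eq_midpoints w'E vars mw c.
    rewrite /= w'g -!w'E // wo.
    by case: xyt => -[-> -> ->]; rewrite w0 w1; ring.
  by rewrite w'g mulN1r opprB subr_ge0 -F.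
rewrite mulN1r opprB subr_ge0 => hbound; split=> //=; apply: le_trans hbound.
rewrite F; apply: psd_le_qform.
case: xyt => -[xE yE ->]; rewrite xE yE in hmean sysE.
  exact: (system_epigraph_sound (@real_complex_le R) hmean uS sysE E0 E1).
have := system_epigraph_sound (@real_complex_le R) hmean uS sysE E1 E0.
suff -> : wmean (- s) b a = wmean (1 + s) a b by [].
by rewrite /wmean opprK opprD addNKr addrC.
Qed.

(** The value is a quadratic form of a positive semidefinite matrix. Being real, it can serve as the
    last coordinate of a point of the graph. *)
Lemma lieb_trace_real t (A : 'M[R[i]]_n) (B : 'M[R[i]]_m) :
  pdmx A -> pdmx B -> exists r : R, lieb_trace K t A B = r%:C.
Proof.
move=> pA pB; apply: real_complex_realP; apply: ger0_real.
have [S [a [b [uS _ _ ->]]]] := lieb_trace_expdiag pA pB.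
by have [_] := expdiag_psd (@real_complex_le R) uS (wmean t a b).
Qed.

End LiebRepresentation.

(** * Convexity from semidefinite representations *)

Lemma affine_comb_sum (F : pzRingType) (V : lmodType F) d (l l' : F) (c : V)
    (A : 'I_d -> V) (x y : 'I_d -> F) : l + l' = 1 ->
  c + \sum_j (l * x j + l' * y j) *: A j
    = l *: (c + \sum_j x j *: A j) + l' *: (c + \sum_j y j *: A j).
Proof.
move=> ll'; rewrite !scalerDr addrACA -scalerDl ll' scale1r.
rewrite !scaler_sumr -big_split /=.
by congr (_ + _); apply: eq_bigr => j _; rewrite !scalerA -scalerDl.
Qed.

Lemma lmi_holds_convex (R : realType) d (L : lmi R d) (l : R) x y :
  0 <= l <= 1 -> lmi_holds x L -> lmi_holds y L ->
  lmi_holds (l *: x + (1 - l) *: y) L.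
Proof.
move=> /andP[l0 l1] /psdmxE hx /psdmxE hy; apply/psdmxE.
have ll' : l%:C + (1 - l)%:C = 1 :> R[i] by rewrite -rmorphD addrC subrK rmorph1.
have := psdD (psdZ _ hx) (psdZ _ hy) => /(_ l%:C (1 - l)%:C).
rewrite !ler0c subr_ge0 -(affine_comb_sum _ _ _ _ ll') => /(_ l0 l1).
suff -> : \sum_(j < d)
    (l%:C * (x ord0 j)%:C + (1 - l)%:C * (y ord0 j)%:C) *: lmi_coef L j
   = \sum_(j < d) ((l *: x + (1 - l) *: y) ord0 j)%:C *: lmi_coef L j by [].
by apply: eq_bigr => j _; rewrite !mxE -!rmorphM -rmorphD.
Qed.

(** The lifting variables are combined with the same weights as the points. *)
Lemma sdp_representation_convex (R : realType) (T : Type) d (coord : T -> 'rV[R]_d)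
    (D S : set T) szs (l : R) x1 x2 x :
  sdp_representation coord D S szs -> 0 <= l <= 1 -> D x1 -> D x2 -> D x ->
  coord x = l *: coord x1 + (1 - l) *: coord x2 -> S x1 -> S x2 -> S x.
Proof.
move=> [k [Ls [_ SP]]] l01 D1 D2 Dx xE /(SP _ D1)[y1 h1] /(SP _ D2)[y2 h2].
apply/(SP _ Dx); exists (l *: y1 + (1 - l) *: y2).
have -> : row_mx (coord x) (l *: y1 + (1 - l) *: y2)
    = l *: row_mx (coord x1) y1 + (1 - l) *: row_mx (coord x2) y2.
  by rewrite xE !scale_row_mx add_row_mx.
elim: Ls h1 h2 {SP} => [_ _|L Ls IH]; first by constructor.
move=> /List.Forall_cons_iff[h1 hs1] /List.Forall_cons_iff[h2 hs2].
constructor; first exact: lmi_holds_convex.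
exact: IH.
Qed.

Lemma pdmx_convex (R : realType) n (A1 A2 : 'M[R[i]]_n) (l : R) :
  0 <= l <= 1 -> pdmx A1 -> pdmx A2 -> pdmx (l%:C *: A1 + (1 - l)%:C *: A2).
Proof.
move=> /andP[l0 l1] [/hermsymP hA1 pA1] [/hermsymP hA2 pA2]; split.
  apply/hermsymP; rewrite adjmxD !adjmxZ hA1 hA2.
  by rewrite (conj_real_complex l) (conj_real_complex (1 - l)).
move=> v nz; have := pA1 v nz; have := pA2 v nz.
rewrite mulmxDr mulmxDl -!scalemxAr -!scalemxAl.
move: (v ^t* *m A1 *m v) (v ^t* *m A2 *m v) => Y1 Y2; rewrite !mxE => y2 y1.
have [->|lneq0] := eqVneq l 0; first by rewrite mul0r add0r subr0 mul1r.
apply: ltr_wpDr; first by rewrite mulr_ge0 ?ler0c ?subr_ge0 // ltW.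
by rewrite mulr_gt0 // ltcR lt_def lneq0.
Qed.

Lemma mx_coord_comb (R : realType) n (A1 A2 : 'M[R[i]]_n) (a b : R) :
  mx_coord (a%:C *: A1 + b%:C *: A2) = a *: mx_coord A1 + b *: mx_coord A2.
Proof.
rewrite /mx_coord !scale_row_mx add_row_mx -!linearZ -!linearD /=.
congr (row_mx (mxvec _) (mxvec _)); apply/matrixP => i j; rewrite !mxE;
  by case: (A1 i j) (A2 i j) => [? ?] [? ?] /=; rewrite !mul0r ?subr0 ?addr0.
Qed.

Lemma triple_coord_comb (R : realType) n m (A1 A2 : 'M[R[i]]_n)
    (B1 B2 : 'M[R[i]]_m) (r1 r2 a b : R) :
  triple_coord (a%:C *: A1 + b%:C *: A2, a%:C *: B1 + b%:C *: B2, a * r1 + b * r2)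
    = a *: triple_coord (A1, B1, r1) + b *: triple_coord (A2, B2, r2).
Proof.
rewrite /triple_coord /= !mx_coord_comb !scale_row_mx !add_row_mx.
by congr row_mx; apply/matrixP => i j; rewrite !mxE.
Qed.

(** Apply convexity of the hypograph to the two graph points [(A1, B1, F A1 B1)] and
    [(A2, B2, F A2 B2)]. *)
Lemma hypograph_sdp_concave (R : realType) n m (F : 'M[R[i]]_n -> 'M[R[i]]_m -> R[i])
    szs :
  (forall A B, pdmx A -> pdmx B -> exists r : R, F A B = r%:C) ->
  sdp_representation (@triple_coord R n m) (@pd_domain R n m) (hypograph F) szs ->
  jointly_concave F.
Proof.
move=> Freal sdp A1 A2 B1 B2 l pA1 pA2 pB1 pB2 l01.
have [r1 F1] := Freal _ _ pA1 pB1; have [r2 F2] := Freal _ _ pA2 pB2.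
have pA := pdmx_convex l01 pA1 pA2; have pB := pdmx_convex l01 pB1 pB2.
have h1 : hypograph F (A1, B1, r1) by split; rewrite //= F1.
have h2 : hypograph F (A2, B2, r2) by split; rewrite //= F2.
have [_ _ /=] := sdp_representation_convex sdp l01
  (conj pA1 pB1 : @pd_domain R n m (A1, B1, r1))
  (conj pA2 pB2 : @pd_domain R n m (A2, B2, r2))
  (conj pA pB : @pd_domain R n m (_, _, l * r1 + (1 - l) * r2))
  (triple_coord_comb _ _ _ _ _ _ _ _) h1 h2.
by rewrite F1 F2 -!rmorphM -rmorphD.
Qed.

Lemma epigraph_sdp_convex (R : realType) n m (F : 'M[R[i]]_n -> 'M[R[i]]_m -> R[i])
    szs :
  (forall A B, pdmx A -> pdmx B -> exists r : R, F A B = r%:C) ->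
  sdp_representation (@triple_coord R n m) (@pd_domain R n m) (epigraph F) szs ->
  jointly_convex F.
Proof.
move=> Freal sdp A1 A2 B1 B2 l pA1 pA2 pB1 pB2 l01.
have [r1 F1] := Freal _ _ pA1 pB1; have [r2 F2] := Freal _ _ pA2 pB2.
have pA := pdmx_convex l01 pA1 pA2; have pB := pdmx_convex l01 pB1 pB2.
have h1 : epigraph F (A1, B1, r1) by split; rewrite //= F1.
have h2 : epigraph F (A2, B2, r2) by split; rewrite //= F2.
have [_ _ /=] := sdp_representation_convex sdp l01
  (conj pA1 pB1 : @pd_domain R n m (A1, B1, r1))
  (conj pA2 pB2 : @pd_domain R n m (A2, B2, r2))
  (conj pA pB : @pd_domain R n m (_, _, l * r1 + (1 - l) * r2))
  (triple_coord_comb _ _ _ _ _ _ _ _) h1 h2.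
by rewrite F1 F2 -!rmorphM -rmorphD.
Qed.

Theorem theorem4 (R : realType) (n m : nat) (K : 'M[R[i]]_(n, m))
    (p : int) (q : nat) (t : R)
    (hq : (1 <= q)%N) (ht : t = p%:~R / q%:R) (htI : -1 <= t <= 2) :
  (0 <= t <= 1 ->
     jointly_concave (lieb_trace K t) /\
     exists c : nat, (c <= 2 * trunc_log 2 q + 1)%N /\
       sdp_representation (@triple_coord R n m) (@pd_domain R n m)
         (hypograph (lieb_trace K t))
         (nseq c (2 * (n * m))%N ++ [:: (n * m)%N; 1%N])) /\
  (-1 <= t <= 0 \/ 1 <= t <= 2 ->
     jointly_convex (lieb_trace K t) /\
     exists c : nat, (c <= 2 * trunc_log 2 q + 2)%N /\
       sdp_representation (@triple_coord R n m) (@pd_domain R n m)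
         (epigraph (lieb_trace K t))
         (nseq c (2 * (n * m))%N ++ [:: (n * m)%N; 1%N])).
Proof.
have q0 : 0 < q%:R :> R by rewrite ltr0n.
have Freal : forall A B, pdmx A -> pdmx B -> exists r : R, lieb_trace K t A B = r%:C.
  by move=> A B; apply: lieb_trace_real.
(* A weight in [[0, 1]] has a natural numerator over the same [q]; the fraction need not be
   reduced. *)
have ratio (z : int) (s : R) : s = z%:~R / q%:R -> 0 <= s <= 1 ->
    exists2 a : nat, (a <= q)%N & s = a%:R / q%:R.
  move=> sE; rewrite sE ler_pdivlMr // ler_pdivrMr // mul0r mul1r.
  rewrite ler0z -[q%:R]/(q%:Z%:~R) ler_int => /andP[].
  by case: z sE => // a sE _ aq; exists a.
have mean (z : int) (s : R) x y : (x < 2)%N -> (y < 2)%N ->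
    s = z%:~R / q%:R -> 0 <= s <= 1 ->
    exists sys g o, size sys = (2 * trunc_log 2 q + 1)%N /\
      mean_system (real_complex R) sys x y 2 g o s.
  move=> x2 y2 sE /(ratio _ _ sE)[a aq ->].
  exact: (rational_mean_system (@real_complex_le R) (@real_complex_realP R)).
split=> [t01|tout].
  have [sys [g [o [sz hmean]]]] := mean _ _ 0%N 1%N isT isT ht t01.
  have sdp := hypograph_sdp K hmean; split; first exact: hypograph_sdp_concave sdp.
  by exists (size sys); split; first by rewrite sz.
suff [c [cle sdp]] : exists c, (c <= 2 * trunc_log 2 q + 2)%N /\
    sdp_representation (@triple_coord R n m) (@pd_domain R n m)
      (epigraph (lieb_trace K t)) (nseq c (2 * (n * m))%N ++ [:: (n * m)%N; 1%N]).
  by split; [exact: epigraph_sdp_convex sdp|exists c].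
case: tout => [/andP[tm1 t0]|/andP[t1 t2]].
  have sE : - t = (- p)%:~R / q%:R by rewrite ht rmorphN mulNr.
  have s01 : 0 <= - t <= 1 by apply/andP; split; lra.
  have [sys [g [o [sz hmean]]]] := mean _ _ 0%N 1%N isT isT sE s01.
  exists (size sys).+1; split; first by rewrite sz -addnS.
  by apply: epigraph_sdp hmean; left; rewrite opprK.
(* The shifted weight keeps the denominator [q], hence the same count of LMIs. *)
have sE : t - 1 = (p - q%:Z)%:~R / q%:R.
  by rewrite ht rmorphB /= mulrBl divff ?lt0r_neq0.
have s01 : 0 <= t - 1 <= 1 by apply/andP; split; lra.
have [sys [g [o [sz hmean]]]] := mean _ _ 1%N 0%N isT isT sE s01.
exists (size sys).+1; split; first by rewrite sz -addnS.
by apply: epigraph_sdp hmean; right; rewrite addrC subrK.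
Qed.
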